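(* Let $A(y)\in\mathbb{R}^{m\times N_z}$ be a twice differentiable matrix-valued function of $y\in\mathbb{R}^{N_y}$ with full column rank for every $y$, let $b\in\mathbb{R}^m$, and consider the separable least squares objective $F(y,z)=\frac12\|A(y)z-b\|^2$. Then Kaufman's variable projection method is equivalent to the simplified semi-reduced method for $F$ using the Gauss-Newton Hessian model $G$; that is, started from $y^0$ and $(y^0,z_m(y^0))$ respectively (with the same parameters $\delta,\alpha$), the two methods generate identical iterates.
   Context: Both methods use fixed parameters $\delta\in(0,1/2)$, $\alpha\in(0,1)$. For a full column rank matrix $X$, $X^{+}=(X^TX)^{-1}X^T$ and $P_X^\perp=I-XX^{+}$; $X_{:,j}$ is the $j$-th column of $X$. Dependence of $A$ on $y$ is suppressed. Here $z_m(y)=\mathrm{argmin}_zF(y,z)=A^{+}b$ and $F_r(y)=F(y,z_m(y))=\frac12\|-P_A^\perp b\|^2$. Gauss-Newton Hessian model. $G(y,z)=J^TJ$, where $J=[J_y,J_z]$ is the Jacobian of $(y,z)\mapsto A(y)z$: $(J_y)_{:,j}=(\partial_{y_j}A)z$ for $j=1,\dots,N_y$, and $J_z=A$. It is assumed (standing assumption on Hessian models) that $G$ is positive definite at every point $(y,z_m(y))$. Kaufman's variable projection method. The backtracking line search method on $F_r$ with Hessian model $\mathscr{B}_r(y)=J_r^TJ_r$, where $(J_r)_{:,j}=-P_A^\perp(\partial_{y_j}A)A^{+}b$: for $k=0,1,2,\dots$, set $g=\nabla F_r(y^k)$, $B_r=\mathscr{B}_r(y^k)$; solve $B_r\Delta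 y=-g$; let $y_p(s)=y^k+s\Delta y$; find the smallest integer $j\ge0$ with $F_r(y_p(\alpha^j))-F_r(y^k)\le\delta g^T(y_p(\alpha^j)-y^k)$; set $y^{k+1}=y_p(\alpha^j)$. Simplified semi-reduced method (with Hessian model $\mathscr{B}_f=G$). Start at $x^0=(y^0,z_m(y^0))$. For $k=0,1,2,\dots$: with $x^k=(y^k,z^k)$, set $g_y=\nabla_yF(x^k)$ and $B=\mathscr{B}_f(x^k)$, with blocks $B_{yy},B_{yz},B_{zy},B_{zz}$, and $B_s=B_{yy}-B_{yz}B_{zz}^{-1}B_{zy}$; solve $B_s\Delta y=-g_y$; let $x_p(s)=(y_p(s),z_p(s))=(y^k+s\Delta y,\ z_m(y^k+s\Delta y))$; find the smallest integer $j\ge0$ with $F(x_p(\alpha^j))-F(x^k)\le\delta g_y^T(y_p(\alpha^j)-y^k)$; set $x^{k+1}=x_p(\alpha^j)$. ''Identical iterates'' means that the vectors $y^k$ produced by the two methods coincide for all $k$ (and $z^k=z_m(y^k)$ in the second method). *)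

(* Defs.v *)
From mathcomp Require Export all_boot all_order all_algebra.
From mathcomp Require Export all_classical all_reals all_analysis.

Set Implicit Arguments.
Unset Strict Implicit.
Unset Printing Implicit Defensive.

Export Order.TTheory GRing.Theory Num.Theory.
Export numFieldNormedType.Exports.

Local Open Scope classical_set_scope.
Local Open Scope ring_scope.

Section LinearAlgebra.
Variable R : realType.

Definition dot n (u v : 'cV[R]_n) : R := (u^T *m v) 0 0.

Definition full_column_rank m n (X : 'M[R]_(m, n)) : Prop := \rank X = n.

(* X^+ and P_X^\perp; meaningful when X has full column rank. *)
Definition pinv m n (X : 'M[R]_(m, n)) : 'M[R]_(n, m) :=
  invmx (X^T *m X) *m X^T.

Definition Pperp m n (X : 'M[R]_(m, n)) : 'M[R]_m := 1%:M - X *m pinv X.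

Definition posdef n (M : 'M[R]_n) : Prop :=
  M^T = M /\ forall v : 'cV[R]_n, v != 0 -> 0 < dot v (M *m v).

End LinearAlgebra.

Section Calculus.
Variable R : realType.

Definition partial n (W : normedModType R) (f : 'cV[R]_n -> W) (j : 'I_n)
  (y : 'cV[R]_n) : W := 'D_(delta_mx j 0) f y.

Definition grad n (f : 'cV[R]_n -> R) (y : 'cV[R]_n) : 'cV[R]_n :=
  \col_j partial f j y.

(* The Frechet derivative 'd f y, a linear map between matrix spaces, is
   represented by its matrix so that differentiability of y |-> 'd f y makes
   sense in a normed space. *)
Definition twice_differentiable n m p (f : 'cV[R]_n -> 'M[R]_(m, p)) : Prop :=
  (forall y, differentiable f y) /\
  (forall y, differentiable (fun x => lin_mx ('d f x)) y).

End Calculus.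

Definition smallest (P : nat -> Prop) (j : nat) : Prop :=
  P j /\ forall i, P i -> (j <= i)%N.

Section Methods.
Variables (R : realType) (delta alpha : R).

(* The methods are relations: x is a (complete, infinite) run from the given
   starting point.  A run has no successor at step k if the linear system or the
   line search has no solution there. *)

Definition backtracking_step n (f : 'cV[R]_n -> R) (B : 'cV[R]_n -> 'M[R]_n)
    (y y' : 'cV[R]_n) : Prop :=
  let g := grad f y in
  exists (dy : 'cV[R]_n) (j : nat),
    let yp s := y + s *: dy in
    [/\ B y *m dy = - g,
        smallest (fun i => f (yp (alpha ^+ i)) - f y
                           <= delta * dot g (yp (alpha ^+ i) - y)) j
      & y' = yp (alpha ^+ j)].

Definition backtracking_iterates n (f : 'cV[R]_n -> R)
    (B : 'cV[R]_n -> 'M[R]_n) (y0 : 'cV[R]_n) (y : nat -> 'cV[R]_n) : Prop :=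
  y 0%N = y0 /\ forall k, backtracking_step f B (y k) (y k.+1).

Definition schur n p (B : 'M[R]_(n + p)) : 'M[R]_n :=
  ulsubmx B - ursubmx B *m invmx (drsubmx B) *m dlsubmx B.

Definition semi_reduced_step n p (F : 'cV[R]_n -> 'cV[R]_p -> R)
    (zm : 'cV[R]_n -> 'cV[R]_p) (B : 'cV[R]_n -> 'cV[R]_p -> 'M[R]_(n + p))
    (x x' : 'cV[R]_n * 'cV[R]_p) : Prop :=
  let: (y, z) := x in
  let gy := grad (F^~ z) y in
  exists (dy : 'cV[R]_n) (j : nat),
    let yp s := y + s *: dy in
    let zp s := zm (y + s *: dy) in
    [/\ schur (B y z) *m dy = - gy,
        smallest (fun i => F (yp (alpha ^+ i)) (zp (alpha ^+ i)) - F y z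
                           <= delta * dot gy (yp (alpha ^+ i) - y)) j
      & x' = (yp (alpha ^+ j), zp (alpha ^+ j))].

Definition semi_reduced_iterates n p (F : 'cV[R]_n -> 'cV[R]_p -> R)
    (zm : 'cV[R]_n -> 'cV[R]_p) (B : 'cV[R]_n -> 'cV[R]_p -> 'M[R]_(n + p))
    (y0 : 'cV[R]_n) (x : nat -> 'cV[R]_n * 'cV[R]_p) : Prop :=
  x 0%N = (y0, zm y0) /\ forall k, semi_reduced_step F zm B (x k) (x k.+1).

End Methods.

Section SeparableLeastSquares.
Variables (R : realType) (m Ny Nz : nat).
Variables (A : 'cV[R]_Ny -> 'M[R]_(m, Nz)) (b : 'cV[R]_m).

(* The norm of the library on matrices is the sup norm, hence dot. *)
Definition objective (y : 'cV[R]_Ny) (z : 'cV[R]_Nz) : R :=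
  2^-1 * dot (A y *m z - b) (A y *m z - b).

(* argmin_z F(y,z); the default value 0 is irrelevant when A y has full column
   rank, the minimizer being then unique and equal to pinv (A y) *m b. *)
Definition zmin (y : 'cV[R]_Ny) : 'cV[R]_Nz :=
  xget 0 [set z | forall z', objective y z <= objective y z'].

Definition reduced_objective (y : 'cV[R]_Ny) : R := objective y (zmin y).

Definition Jac_y (y : 'cV[R]_Ny) (z : 'cV[R]_Nz) : 'M[R]_(m, Ny) :=
  \matrix_(i, j) (partial A j y *m z) i 0.

Definition Jac (y : 'cV[R]_Ny) (z : 'cV[R]_Nz) : 'M[R]_(m, Ny + Nz) :=
  row_mx (Jac_y y z) (A y).

Definition gauss_newton (y : 'cV[R]_Ny) (z : 'cV[R]_Nz) : 'M[R]_(Ny + Nz) :=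
  (Jac y z)^T *m Jac y z.

Definition kaufman_Jac (y : 'cV[R]_Ny) : 'M[R]_(m, Ny) :=
  \matrix_(i, j) (- (Pperp (A y) *m partial A j y *m pinv (A y) *m b)) i 0.

Definition kaufman_hessian (y : 'cV[R]_Ny) : 'M[R]_Ny :=
  (kaufman_Jac y)^T *m kaufman_Jac y.

Definition kaufman_iterates (delta alpha : R) (y0 : 'cV[R]_Ny)
    (y : nat -> 'cV[R]_Ny) : Prop :=
  backtracking_iterates delta alpha reduced_objective kaufman_hessian y0 y.

Definition gauss_newton_semi_reduced_iterates (delta alpha : R)
    (y0 : 'cV[R]_Ny) (x : nat -> 'cV[R]_Ny * 'cV[R]_Nz) : Prop :=
  semi_reduced_iterates delta alpha objective zmin gauss_newton y0 x.

End SeparableLeastSquares.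

(* Main.v *)
Require Import Defs.

Set Implicit Arguments.
Unset Strict Implicit.
Unset Printing Implicit Defensive.

Local Open Scope classical_set_scope.
Local Open Scope ring_scope.

(** Kaufman's method and the simplified semi-reduced method are, step by step,
    the same backtracking method, because three ingredients agree at every point
    (y, zm(y)).

    - The line-search functions agree by definition: F(y, zm(y)) = F_r(y), and
      the semi-reduced trial points are always of the form (y, zm(y)).
    - The gradients agree.  Differentiating F_r = |r|^2 / 2 along
      r(y) = A(y) zm(y) - b gives two terms, and the one carrying the derivative
      of zm is the inner product of A(y) D zm with r, which vanishes by the normal
      equations A^T r = 0.  What remains is J_y^T r, the partial gradient
      of F in y ([grad_reduced_objective]).  This needs zm = A^+ b to be
      differentiable along lines, which follows from Cramer's formula
      ([derivable_invmx], [derivable_zmin]).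
    - The Hessian models agree.  The Schur complement of the Gauss-Newton matrix
      is J_y^T P J_y with P the orthogonal projector onto the complement of the
      range of A, hence equal to (P J_y)^T (P J_y), and the Kaufman Jacobian is
      - P J_y ([Pperp_schur], [schur_gauss_newton]).

    The runs are moreover unique and never stop.  The Schur complement of
    a positive definite matrix is positive definite ([schur_posdef]), so
    the search direction exists, is unique, and is a descent direction unless it
    is zero; the slope of F_r along it is the inner product with the gradient, so
    the line search succeeds after finitely many reductions
    ([sufficient_decrease_exists], [backtracking_step_exists]).  Each method is
    therefore the iteration of a single-valued total step ([run_exists_unique]),
    and the two steps correspond under y |-> (y, zm(y)) ([semi_reduced_stepE]). *)

(** * Euclidean inner product, positive definiteness and Schur complements *)

Section Algebra.
Variable R : realType.

Lemma dotC n (u v : 'cV[R]_n) : dot u v = dot v u.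
Proof. by rewrite /dot -[LHS]trace_mx11 -mxtrace_tr trmx_mul trmxK trace_mx11. Qed.

Lemma dotDl n (u v w : 'cV[R]_n) : dot (u + v) w = dot u w + dot v w.
Proof. by rewrite /dot linearD mulmxDl mxE. Qed.

Lemma dotDr n (u v w : 'cV[R]_n) : dot u (v + w) = dot u v + dot u w.
Proof. by rewrite /dot mulmxDr mxE. Qed.

Lemma dotNr n (u v : 'cV[R]_n) : dot u (- v) = - dot u v.
Proof. by rewrite /dot mulmxN mxE. Qed.

Lemma dotZr n a (u v : 'cV[R]_n) : dot u (a *: v) = a * dot u v.
Proof. by rewrite /dot -scalemxAr mxE. Qed.

Lemma dot_mull m n (M : 'M[R]_(m, n)) (u : 'cV[R]_n) (v : 'cV[R]_m) :
  dot (M *m u) v = dot u (M^T *m v).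
Proof. by rewrite /dot trmx_mul mulmxA. Qed.

Lemma dotE n (u v : 'cV[R]_n) : dot u v = \sum_i u i 0 * v i 0.
Proof. by rewrite /dot mxE; apply: eq_bigr => i _; rewrite mxE. Qed.

Lemma dot_ge0 n (u : 'cV[R]_n) : 0 <= dot u u.
Proof. by rewrite dotE sumr_ge0// => i _; rewrite -expr2 sqr_ge0. Qed.

Lemma dot_eq0 n (u : 'cV[R]_n) : (dot u u == 0) = (u == 0).
Proof.
apply/eqP/eqP => [|->]; last by rewrite /dot mulmx0 mxE.
rewrite dotE => /eqP; rewrite psumr_eq0; last first.
  by move=> i _; rewrite -expr2 sqr_ge0.
move=> /allP u0; apply/colP => i; rewrite mxE; apply/eqP.
by have := u0 i (mem_index_enum i); rewrite /= -expr2 sqrf_eq0.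
Qed.

Lemma unitmx_ker0 n (M : 'M[R]_n) :
  (forall v : 'cV[R]_n, M *m v = 0 -> v = 0) -> M \in unitmx.
Proof.
move=> M0; rewrite -unitmx_tr -row_free_unit -kermx_eq0.
apply/eqP/row_matrixP => i; rewrite row0; apply: trmx_inj; rewrite trmx0.
apply: M0; apply: trmx_inj; rewrite trmx_mul trmxK trmx0.
by rewrite -row_mul mulmx_ker row0.
Qed.

Lemma posdef_unitmx n (M : 'M[R]_n) : posdef M -> M \in unitmx.
Proof.
move=> [_ Mpos]; apply: unitmx_ker0 => v Mv0; apply/eqP/negP => /negP v0.
by have := Mpos _ v0; rewrite Mv0 /dot mulmx0 mxE ltxx.
Qed.

Lemma posdef_gram m n (X : 'M[R]_(m, n)) :
  (forall v : 'cV[R]_n, X *m v = 0 -> v = 0) -> posdef (X^T *m X).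
Proof.
move=> X0; split=> [|v v0]; first by rewrite trmx_mul trmxK.
rewrite -mulmxA -[X in dot v (_ *m X)]/(X *m v) -dot_mull.
rewrite lt_neqAle dot_ge0 andbT eq_sym dot_eq0.
by apply: contra v0 => /eqP/X0 ->.
Qed.

Section FullColumnRank.
Variables (m n : nat) (X : 'M[R]_(m, n)).
Hypothesis fX : full_column_rank X.

Lemma full_column_rank_inj (v : 'cV[R]_n) : X *m v = 0 -> v = 0.
Proof.
move=> Xv0; apply: trmx_inj; rewrite trmx0.
have rX : row_free X^T by rewrite /row_free mxrank_tr fX.
by apply: (row_free_inj rX); rewrite mul0mx -trmx_mul Xv0 trmx0.
Qed.

Lemma gram_unitmx : X^T *m X \in unitmx.
Proof. exact/posdef_unitmx/posdef_gram/full_column_rank_inj. Qed.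

Lemma normal_equations (b : 'cV[R]_m) : X^T *m (X *m (pinv X *m b) - b) = 0.
Proof.
by rewrite /pinv mulmxBr !mulmxA mulmxV ?gram_unitmx// mul1mx subrr.
Qed.

(** [Pperp X] is an orthogonal projector: X^T [Pperp X] = 0 makes it idempotent,
    and it is symmetric. *)
Lemma Pperp_gram : (Pperp X)^T *m Pperp X = Pperp X.
Proof.
have PX0 : X^T *m Pperp X = 0.
  by rewrite /Pperp /pinv mulmxBr mulmx1 !mulmxA mulmxV ?gram_unitmx// mul1mx subrr.
have -> : (Pperp X)^T = 1%:M - X *m invmx (X^T *m X) *m X^T.
  by rewrite /Pperp /pinv linearB/= trmx1 !trmx_mul trmx_inv trmx_mul !trmxK.
by rewrite mulmxBl mul1mx -[X in _ - X]mulmxA PX0 mulmx0 subr0.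
Qed.

(** Eliminating the X-block of the Gram matrix of [Y X] leaves Y^T P Y, where
    P = P^T P; this is the least squares reading of the Schur complement. *)
Lemma Pperp_schur p (Y : 'M[R]_(m, p)) :
  schur ((row_mx Y X)^T *m row_mx Y X) = (Pperp X *m Y)^T *m (Pperp X *m Y).
Proof.
rewrite tr_row_mx mul_col_row /schur block_mxKul block_mxKur block_mxKdr block_mxKdl.
rewrite trmx_mul -[in RHS]mulmxA [X in _ = _ *m X]mulmxA Pperp_gram.
by rewrite /Pperp /pinv mulmxBl mul1mx mulmxBr !mulmxA.
Qed.

(** If P Y v = 0 then Y v lies in the range of X, so (v, - X^+ Y v) is in
    the kernel of [Y X], which positive definiteness of the Gram matrix makes
    trivial. *)
Lemma schur_posdef p (Y : 'M[R]_(m, p)) :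
  posdef ((row_mx Y X)^T *m row_mx Y X) ->
  posdef (schur ((row_mx Y X)^T *m row_mx Y X)).
Proof.
move=> pJ; rewrite Pperp_schur; apply: posdef_gram => v PYv0.
pose w := col_mx v (- (pinv X *m Y *m v)).
have Jw0 : row_mx Y X *m w = 0.
  rewrite mul_row_col mulmxN -[RHS]PYv0 /Pperp mulmxBl mul1mx mulmxBl.
  by rewrite !mulmxA.
have : w = 0.
  apply/eqP/negP => /negP w0; have [_ /(_ _ w0)] := pJ.
  by rewrite -mulmxA Jw0 mulmx0 /dot mulmx0 mxE ltxx.
by rewrite -[RHS]col_mx0 => /eq_col_mx[].
Qed.

End FullColumnRank.
End Algebra.

(** * Directional derivatives of matrix-valued functions *)

Section MatrixCalculus.
Variables (R : realType) (V : normedModType R).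

Lemma derivable_big (I : Type) (op : R -> R -> R) (idx : R) (r : seq I)
    (P : pred I) (F : I -> V -> R) x v :
  (forall f g : V -> R, derivable f x v -> derivable g x v ->
     derivable (fun t => op (f t) (g t)) x v) ->
  (forall i, P i -> derivable (F i) x v) ->
  derivable (fun t => \big[op/idx]_(i <- r | P i) F i t) x v.
Proof.
move=> dop dF; elim: r => [|i r IH].
  by under eq_fun do rewrite big_nil; exact: derivable_cst.
under eq_fun do rewrite big_cons.
by case: ifP => // Pi; apply: dop => //; exact: dF.
Qed.

Lemma derive_coord m n (M : V -> 'M[R]_(m, n)) x v i j :
  derivable M x v -> 'D_v (fun t => M t i j) x = 'D_v M x i j.
Proof. by move=> dM; rewrite derive_mx// mxE. Qed.

Lemma is_derive_coord m n (M : V -> 'M[R]_(m, n)) x v i j :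
  derivable M x v -> is_derive x v (fun t => M t i j) ('D_v M x i j).
Proof.
move=> dM; rewrite -derive_coord//; apply/derivableP.
exact: (derivable_mxP M x v).1 dM i j.
Qed.

Lemma is_derive_mulmx m n p (M : V -> 'M[R]_(m, n)) (N : V -> 'M[R]_(n, p)) x v :
  derivable M x v -> derivable N x v ->
  is_derive x v (fun t => M t *m N t) ('D_v M x *m N x + M x *m 'D_v N x).
Proof.
move=> dM dN.
have key i j : is_derive x v (fun t => (M t *m N t) i j)
    (('D_v M x *m N x + M x *m 'D_v N x) i j).
  have -> : (fun t => (M t *m N t) i j) =
      \sum_k ((fun t => M t i k) * (fun t => N t k j)).
    by apply/funext => t; rewrite fct_sumE mxE.
  apply: is_derive_eq.
    apply: is_derive_sum => k.
    by apply: is_deriveM; exact: is_derive_coord.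
  rewrite !mxE -big_split/=; apply: eq_bigr => k _.
  by rewrite /GRing.scale/= addrC; congr (_ + _); rewrite mulrC.
have dMN : derivable (fun t => M t *m N t) x v.
  by apply/derivable_mxP => i j; case: (key i j).
apply: DeriveDef => //; apply/matrixP => i j.
by rewrite -derive_coord//; case: (key i j).
Qed.

Lemma derivable_mulmx m n p (M : V -> 'M[R]_(m, n)) (N : V -> 'M[R]_(n, p)) x v :
  derivable M x v -> derivable N x v -> derivable (fun t => M t *m N t) x v.
Proof. by move=> dM dN; case: (is_derive_mulmx dM dN). Qed.

Lemma is_derive_trmx m n (M : V -> 'M[R]_(m, n)) x v :
  derivable M x v -> is_derive x v (fun t => (M t)^T) ('D_v M x)^T.
Proof.
move=> dM.
have E i j : (fun t => (M t)^T i j) = (fun t => M t j i).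
  by apply/funext => t; rewrite mxE.
have dMT : derivable (fun t => (M t)^T) x v.
  apply/derivable_mxP => i j; rewrite E.
  exact: (derivable_mxP M x v).1 dM j i.
apply: DeriveDef => //; apply/matrixP => i j.
by rewrite -derive_coord// E derive_coord// mxE.
Qed.

(** Entrywise derivability is assumed because the minors in Cramer's formula are
    obtained entry by entry. *)
Lemma derivable_det n (M : V -> 'M[R]_n) x v :
  (forall i j, derivable (fun t => M t i j) x v) ->
  derivable (fun t => \det (M t)) x v.
Proof.
move=> dM; apply: derivable_big => [f g|s _]; first exact: derivableD.
apply: (@derivableM _ _ (cst _)); first exact: derivable_cst.
by apply: derivable_big => [f g|i _]; [exact: derivableM|exact: dM].
Qed.

(** By Cramer's formula, each entry of the inverse is a quotient of determinants.
    Invertibility is assumed everywhere, not just at x, so that the formula holds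
    for the function itself and no neighbourhood is involved. *)
Lemma derivable_invmx n (M : V -> 'M[R]_n) x v :
  (forall t, M t \in unitmx) -> derivable M x v ->
  derivable (fun t => invmx (M t)) x v.
Proof.
move=> uM /derivable_mxP dM; apply/derivable_mxP => i j.
have -> : (fun t => invmx (M t) i j) =
    (fun t => (\det (M t))^-1) * (cst ((-1) ^+ (j + i)) *
              (fun t => \det (row' j (col' i (M t))))).
  by apply/funext => t; rewrite /invmx uM !mxE.
apply: derivableM.
  apply: derivableV; last exact: derivable_det.
  by rewrite -unitfE -unitmxE.
apply: derivableM; first exact: derivable_cst.
apply: derivable_det => k l; under eq_fun do rewrite !mxE; exact: dM.
Qed.

Lemma is_derive_half_sqr n (u : V -> 'cV[R]_n) x v :
  derivable u x v ->
  is_derive x v (fun t => 2^-1 * dot (u t) (u t)) (dot ('D_v u x) (u x)).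
Proof.
move=> du; have dT := is_derive_trmx du.
have dd : is_derive x v (fun t => dot (u t) (u t)) (2 * dot ('D_v u x) (u x)).
  case: dT => dT DT; case: (is_derive_mulmx dT du) => d Dd.
  have := is_derive_coord 0 0 d.
  rewrite Dd DT mxE -/(dot ('D_v u x) (u x)).
  by rewrite -/(dot (u x) ('D_v u x)) (dotC (u x)) -mulr2n -[_ *+ 2]mulr_natl.
have := is_deriveZ 2^-1 dd.
by rewrite /GRing.scale/= mulKf ?pnatr_eq0.
Qed.

End MatrixCalculus.

(** * Backtracking steps and their iteration *)

Section LineSearch.
Variable R : realType.
Variables (delta alpha : R).
Hypotheses (delta_lt1 : delta < 1) (alpha01 : 0 < alpha < 1).

Lemma smallest_exists (P : nat -> Prop) : (exists i, P i) -> exists j, smallest P j.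
Proof.
move=> [i Pi]; have exP : exists i, `[< P i >] by exists i; exact/asboolP.
have [j /asboolP Pj minj] := ex_minnP exP.
by exists j; split=> // k Pk; apply: minj; exact/asboolP.
Qed.

Lemma smallest_unique (P : nat -> Prop) i j : smallest P i -> smallest P j -> i = j.
Proof.
by move=> [Pi mi] [Pj mj]; apply/eqP; rewrite eqn_leq mi// mj.
Qed.

(** The difference quotients tend to the negative slope D, which is strictly below
    delta D as delta < 1; the step lengths alpha^i tend to 0, so one of them
    satisfies the sufficient decrease test. *)
Lemma sufficient_decrease_exists n (f : 'cV[R]_n -> R) y v :
  derivable f y v -> 'D_v f y < 0 ->
  exists i, f (y + alpha ^+ i *: v) - f y <= delta * (alpha ^+ i * 'D_v f y).
Proof.
move=> df D0; have /andP[a0 a1] := alpha01.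
have D_lt : 'D_v f y < delta * 'D_v f y by rewrite ltr_nMl.
have [e /= e0 quot_lt] : \forall h \near (0 : R)^',
    h^-1 *: (f (h *: v + y) - f y) < delta * 'D_v f y.
  exact: (cvgr_lt _ df).
have pow0 : (alpha ^+ i : R) @[i --> \oo] --> (0 : R).
  by apply: cvg_expr; rewrite gtr0_norm.
move/cvgrPdist_lt: pow0 => /(_ _ e0)[i _ /(_ i (leqnn i))].
have ai0 : 0 < alpha ^+ i by rewrite exprn_gt0.
move=> /quot_lt/(_ (lt0r_neq0 ai0)); exists i.
by rewrite mulrCA -ler_pdivrMl// [y + _]addrC ltW.
Qed.

Section Step.
Variables (n : nat) (f : 'cV[R]_n -> R) (B : 'cV[R]_n -> 'M[R]_n).
Hypothesis df : forall y v, is_derive y v f (dot (grad f y) v).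
Hypothesis posB : forall y, posdef (B y).

(** The slope along the search direction dy is - dy^T B dy, negative unless
    dy = 0. *)
Lemma backtracking_step_exists y : exists y', backtracking_step delta alpha f B y y'.
Proof.
pose dy := - (invmx (B y) *m grad f y).
have Bdy : B y *m dy = - grad f y.
  by rewrite mulmxN mulmxA mulmxV ?posdef_unitmx// mul1mx.
suff [j minj] : exists j, smallest (fun i =>
    f (y + alpha ^+ i *: dy) - f y <=
    delta * dot (grad f y) (y + alpha ^+ i *: dy - y)) j.
  by exists (y + alpha ^+ j *: dy), dy, j.
apply: smallest_exists; have [dy0|dy0] := eqVneq dy 0.
  (* At a critical point every step length passes the test, with 0 <= 0. *)
  by exists 0%N; rewrite dy0 scaler0 addr0 !subrr /dot mulmx0 mxE mulr0.
have [dfy Dfy] := df y dy.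
have : 'D_dy f y < 0.
  rewrite Dfy -[grad f y]opprK -Bdy dotC dotNr oppr_lt0.
  by have [_] := posB y; exact.
move=> /(sufficient_decrease_exists dfy)[i fi]; exists i.
by rewrite [y + _ - y]addrC addKr dotZr -Dfy.
Qed.

Lemma backtracking_step_unique y y1 y2 :
  backtracking_step delta alpha f B y y1 ->
  backtracking_step delta alpha f B y y2 -> y1 = y2.
Proof.
move=> [d1 [j1 [B1 m1 ->]]] [d2 [j2 [B2 m2 ->]]].
have d12 : d1 = d2.
  by rewrite -[d1](mulKmx (posdef_unitmx (posB y))) B1 -B2 mulKmx ?posdef_unitmx.
by rewrite d12 in m1 *; rewrite (smallest_unique m1 m2).
Qed.

End Step.
End LineSearch.

(** The runs of a single-valued and total step are the iterates of a function. *)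
Lemma run_exists_unique T (step : T -> T -> Prop) (x0 : T) :
  (forall x, exists x', step x x') ->
  (forall x x1 x2, step x x1 -> step x x2 -> x1 = x2) ->
  exists x : nat -> T, forall x' : nat -> T,
    (x' 0%N = x0 /\ forall k, step (x' k) (x' k.+1)) <-> forall k, x' k = x k.
Proof.
move=> /choice[next stepP] stepU; exists (fun k => iter k next x0) => x'.
split=> [[x'0 x'S] k|x'E]; last first.
  by split=> [|k]; rewrite !x'E// iterS.
by elim: k => //= k IH; apply: stepU (x'S k) _; rewrite IH.
Qed.

(** * Variable projection for separable least squares *)

Section VariableProjection.
Variables (R : realType) (m Ny Nz : nat).
Variables (A : 'cV[R]_Ny -> 'M[R]_(m, Nz)) (b : 'cV[R]_m).
Hypothesis dA : forall y, differentiable A y.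
Hypothesis fA : forall y, full_column_rank (A y).

(** By the normal equations the residual at A^+ b is orthogonal to the range
    of A. *)
Lemma objective_pythagoras y z :
  objective A b y z = objective A b y (pinv (A y) *m b) +
    2^-1 * dot (A y *m (z - pinv (A y) *m b)) (A y *m (z - pinv (A y) *m b)).
Proof.
rewrite /objective; set zb := pinv _ *m b.
have -> : A y *m z - b = (A y *m zb - b) + A y *m (z - zb).
  by rewrite mulmxBr [RHS]addrC addrA subrK.
have orth : dot (A y *m (z - zb)) (A y *m zb - b) = 0.
  by rewrite dot_mull normal_equations// /dot mulmx0 mxE.
move: orth; move: (A y *m zb - b) (A y *m (z - zb)) => r w wr0.
by rewrite -mulrDr dotDl !dotDr wr0 dotC wr0 addr0 add0r.
Qed.

(** The excess of F(y, .) over its value at A^+ b is half of |A (z - A^+ b)|^2,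
    which vanishes only at A^+ b since A is injective. *)
Lemma zminE y : zmin A b y = pinv (A y) *m b.
Proof.
have half_gt0 : 0 < 2^-1 :> R by rewrite invr_gt0 ltr0n.
have : [set z | forall z', objective A b y z <= objective A b y z'] (zmin A b y).
  apply: (@xgetPex _ 0); exists (pinv (A y) *m b) => z'.
  by rewrite (objective_pythagoras y z') lerDl pmulr_rge0// dot_ge0.
move=> /(_ (pinv (A y) *m b)); rewrite objective_pythagoras gerDl pmulr_rle0//.
move=> le0; apply/eqP; rewrite -subr_eq0; apply/eqP.
apply: (full_column_rank_inj (fA y)); apply/eqP.
by rewrite -dot_eq0 eq_le le0 dot_ge0.
Qed.

Lemma derive_dirE y v : 'D_v A y = \sum_j v j 0 *: partial A j y.
Proof.
rewrite deriveE//.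
have {1}-> : v = \sum_j v j 0 *: delta_mx j 0.
  rewrite {1}(matrix_sum_delta v); apply: eq_bigr => j _.
  by rewrite big_ord1.
rewrite linear_sum; apply: eq_bigr => j _.
by rewrite linearZ /partial deriveE.
Qed.

(** Where differentiability, rather than mere existence of the partial
    derivatives, enters: the derivative along v is linear in v. *)
Lemma Jac_y_mul y z v : Jac_y A y z *m v = 'D_v A y *m z.
Proof.
apply/colP => i; rewrite derive_dirE mulmx_suml summxE mxE; apply: eq_bigr => j _.
by rewrite mxE -scalemxAl [in RHS]mxE mulrC.
Qed.

Lemma is_derive_residual (u : 'cV[R]_Ny -> 'cV[R]_Nz) y v :
  derivable u y v ->
  is_derive y v (fun t => A t *m u t - b)
    (Jac_y A y (u y) *m v + A y *m 'D_v u y).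
Proof.
move=> du; have dAu := is_derive_mulmx (diff_derivable (v := v) (dA y)) du.
have := is_deriveB dAu (is_derive_cst b y v).
by rewrite subr0 Jac_y_mul.
Qed.

Lemma is_derive_objective y z v :
  is_derive y v ((objective A b)^~ z) (dot (Jac_y A y z *m v) (A y *m z - b)).
Proof.
have [dr Dr] := is_derive_residual (derivable_cst z y v).
rewrite derive_cst mulmx0 addr0 in Dr.
by rewrite -Dr; exact: is_derive_half_sqr.
Qed.

Lemma derivable_zmin y v : derivable (zmin A b) y v.
Proof.
have -> : zmin A b = (fun t => pinv (A t) *m b) by apply/funext => t; exact: zminE.
have dAv := diff_derivable (v := v) (dA y).
have [dAT _] := is_derive_trmx dAv.
apply: derivable_mulmx; last exact: derivable_cst.
apply: derivable_mulmx => //; apply: derivable_invmx; last exact: derivable_mulmx.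
by move=> t; exact: gram_unitmx.
Qed.

(** The derivative of [zmin] contributes (D_v zmin)^T A^T r, which is zero by
    the normal equations: F_r has the same slope as F with z frozen at zmin. *)
Lemma is_derive_reduced_objective y v :
  is_derive y v (reduced_objective A b)
    (dot (Jac_y A y (zmin A b y) *m v) (A y *m zmin A b y - b)).
Proof.
have [dr Dr] := is_derive_residual (@derivable_zmin y v).
have normal0 : (A y)^T *m (A y *m zmin A b y - b) = 0.
  by rewrite zminE normal_equations.
have := is_derive_half_sqr dr; rewrite Dr dotDl (dot_mull (A y)) normal0.
by rewrite [dot _ 0]/dot mulmx0 [X in _ + X]mxE addr0.
Qed.

(** A slope of the form (J v)^T r for every v identifies the gradient as J^T r;
    applied to F_r and to F(., z) with the same J and r. *)
Lemma grad_chain (f : 'cV[R]_Ny -> R) y (J : 'M[R]_(m, Ny)) (r : 'cV[R]_m) :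
  (forall v, is_derive y v f (dot (J *m v) r)) -> grad f y = J^T *m r.
Proof.
move=> df; apply/colP => j; rewrite mxE /partial.
have [_ ->] := df (delta_mx j 0).
by rewrite dot_mull /dot trmx_delta -rowE mxE.
Qed.

Lemma grad_reduced_objective y :
  grad (reduced_objective A b) y = grad ((objective A b)^~ (zmin A b y)) y.
Proof.
rewrite (grad_chain (is_derive_reduced_objective y)).
by rewrite (grad_chain (is_derive_objective y (zmin A b y))).
Qed.

Lemma is_derive_reduced_objective_grad y v :
  is_derive y v (reduced_objective A b) (dot (grad (reduced_objective A b) y) v).
Proof.
have dF := is_derive_reduced_objective y.
by rewrite (grad_chain dF) dot_mull trmxK dotC; exact: dF.
Qed.

Lemma kaufman_JacE y : kaufman_Jac A b y = - (Pperp (A y) *m Jac_y A y (zmin A b y)).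
Proof.
apply/matrixP => i j; rewrite zminE [LHS]mxE [LHS]mxE [RHS]mxE.
congr (- _); rewrite -mulmxA -mulmxA mxE [RHS]mxE; apply: eq_bigr => k _.
by congr (_ * _); rewrite [RHS]mxE.
Qed.

Lemma schur_gauss_newton y :
  schur (gauss_newton A y (zmin A b y)) = kaufman_hessian A b y.
Proof.
rewrite /gauss_newton Pperp_schur// /kaufman_hessian kaufman_JacE.
by rewrite [(- _)^T]linearN/= mulNmx mulmxN opprK.
Qed.

Lemma semi_reduced_stepE delta alpha y x' :
  semi_reduced_step delta alpha (objective A b) (zmin A b) (gauss_newton A)
    (y, zmin A b y) x' <->
  exists2 y', x' = (y', zmin A b y') &
    backtracking_step delta alpha (reduced_objective A b) (kaufman_hessian A b) y y'.
Proof.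
rewrite /semi_reduced_step /backtracking_step.
rewrite schur_gauss_newton grad_reduced_objective.
split=> [[dy [j [Bdy minj ->]]]|[_ -> [dy [j [Bdy minj ->]]]]].
  by exists (y + alpha ^+ j *: dy) => //; exists dy, j.
by exists dy, j.
Qed.

(** The z-component of every iterate is zmin of its y-component: the starting
    point has this form, and each step produces a point of this form. *)
Lemma semi_reduced_iteratesE delta alpha y0 x' :
  gauss_newton_semi_reduced_iterates A b delta alpha y0 x' <->
  exists2 y', forall k, x' k = (y' k, zmin A b (y' k)) &
    kaufman_iterates A b delta alpha y0 y'.
Proof.
split=> [[x'0 x'S]|[y' x'E [y'0 y'S]]].
  have x'E k : x' k = ((x' k).1, zmin A b (x' k).1).
    case: k => [|k]; first by rewrite x'0.
    elim: k => [|k IH].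
      by have := x'S 0%N; rewrite x'0 => /semi_reduced_stepE[y' ->].
    by have := x'S k.+1; rewrite IH => /semi_reduced_stepE[y' ->].
  exists (fun k => (x' k).1) => //; split=> [|k]; first by rewrite x'0.
  by have := x'S k; rewrite {1}x'E => /semi_reduced_stepE[y' ->].
split=> [|k]; first by rewrite x'E y'0.
by rewrite !x'E; apply/semi_reduced_stepE; exists (y' k.+1).
Qed.

End VariableProjection.

Theorem corollary5 (R : realType) (m Ny Nz : nat)
  (A : 'cV[R]_Ny -> 'M[R]_(m, Nz)) (b : 'cV[R]_m) (delta alpha : R)
  (hdelta : 0 < delta < 2^-1) (halpha : 0 < alpha < 1)
  (hA : twice_differentiable A)
  (hrank : forall y : 'cV[R]_Ny, full_column_rank (A y))
  (hG : forall y : 'cV[R]_Ny, posdef (gauss_newton A y (zmin A b y)))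
  (y0 : 'cV[R]_Ny) :
  exists y : nat -> 'cV[R]_Ny,
    (forall y' : nat -> 'cV[R]_Ny,
       kaufman_iterates A b delta alpha y0 y' <-> forall k, y' k = y k) /\
    (forall x' : nat -> 'cV[R]_Ny * 'cV[R]_Nz,
       gauss_newton_semi_reduced_iterates A b delta alpha y0 x' <->
       forall k, x' k = (y k, zmin A b (y k))).
Proof.
have [dA _] := hA.
have delta_lt1 : delta < 1.
  have /andP[_ /lt_trans] := hdelta; apply.
  by rewrite invf_lt1 ?ltr1n// ltr0n.
have posB y : posdef (kaufman_hessian A b y).
  by rewrite -schur_gauss_newton//; exact (schur_posdef (hrank y) (hG y)).
have [y yP] := run_exists_unique y0
  (backtracking_step_exists delta_lt1 halpha
     (is_derive_reduced_objective_grad b dA hrank) posB)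
  (backtracking_step_unique posB).
exists y; split=> // x'; rewrite semi_reduced_iteratesE//.
split=> [[y' x'E /yP y'E] k|x'E]; first by rewrite x'E y'E.
by exists y => //; exact/yP.
Qed.
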